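(* Let $f:X\longrightarrow Y$ be a covering map of degree $n$ of Hausdorff, path-connected, locally contractible and locally compact topological spaces. Then in $\operatorname{Sh}(Y)$ there is an isomorphism $$f_{\ast}\underline{\mathbb{Q}}_{X}\cong\underline{\mathbb{Q}}_{Y}\oplus\mathcal{L},$$ where $\mathcal{L}$ is a local system of rank $n-1$.
   Context: The covering is unramified and of finite degree $n$. $\underline{\mathbb{Q}}_{X}$, $\underline{\mathbb{Q}}_{Y}$ denote the constant sheaves with stalk $\mathbb{Q}$. $\operatorname{Sh}(Y)$ is the category of sheaves (of $\mathbb{Q}$-vector spaces) on $Y$. A local system is a locally constant sheaf. *)

(* Defs.v *)
From HB Require Import structures.
From mathcomp Require Import all_boot all_order all_algebra.
From mathcomp Require Import all_classical all_reals all_analysis.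

Set Implicit Arguments.
Unset Strict Implicit.
Unset Printing Implicit Defensive.

Import Order.TTheory GRing.Theory Num.Theory.
Import numFieldNormedType.Exports.

Local Open Scope classical_set_scope.
Local Open Scope ring_scope.
Local Open Scope card_scope.

(* Nonemptiness is part of the convention: the empty space is not
   path-connected. *)
Definition path_connected (R : realType) (T : topologicalType) : Prop :=
  [set: T] !=set0 /\
  forall x y : T, exists g : R -> T,
    [/\ {within `[0%R, 1%R]%classic, continuous g}, g 0 = x & g 1 = y].

(* The inclusion of [V] into [U] is homotopic, inside [U], to a constant map. *)
Definition null_homotopic_in (R : realType) (T : topologicalType)
    (V U : set T) : Prop :=
  exists (H : R * T -> T) (c : T),
    [/\ {within `[0%R, 1%R]%classic `*` V, continuous H},
        forall t x, `[0%R, 1%R]%classic t -> V x -> U (H (t, x)),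
        forall x, V x -> H (0, x) = x &
        forall x, V x -> H (1, x) = c].

(* Weak (Borsuk) local contractibility; spaces with a basis of contractible
   neighbourhoods satisfy it. *)
Definition locally_contractible (R : realType) (T : topologicalType) : Prop :=
  forall (x : T) (U : set T), nbhs x U ->
    exists V : set T, [/\ nbhs x V, V `<=` U & null_homotopic_in R V U].

Definition homeomorphism_on (X Y : topologicalType) (f : X -> Y)
    (U : set X) (V : set Y) : Prop :=
  exists g : Y -> X,
    [/\ f @` U `<=` V /\ g @` V `<=` U,
        (forall x, U x -> g (f x) = x),
        (forall y, V y -> f (g y) = y),
        {within U, continuous f} &
        {within V, continuous g}].

Definition evenly_covered (X Y : topologicalType) (f : X -> Y) (V : set Y) :
    Prop :=
  exists (I : Type) (U : I -> set X),
    [/\ forall i, open (U i), trivIset [set: I] U,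
        f @^-1` V = \bigcup_i U i &
        forall i, homeomorphism_on f (U i) V].

(* The degree is the common cardinality of the fibres. Surjectivity is not
   required separately: it holds as soon as [X] is nonempty. *)
Record covering_map (X Y : topologicalType) (f : X -> Y) (n : nat) : Prop :=
  CoveringMap {
    covering_continuous : continuous f;
    covering_even : forall y : Y,
      exists V : set Y, [/\ open V, V y & evenly_covered f V];
    covering_degree : forall y : Y, f @^-1` [set y] #= `I_n }.

Record opens (T : topologicalType) := Opens {
  opens_set :> set T;
  opensP : open opens_set }.

Definition opensI (T : topologicalType) (U V : opens T) : opens T :=
  Opens (openI (opensP U) (opensP V)).

Record presheaf (T : topologicalType) := Presheaf {
  sections :> opens T -> lmodType rat;
  res : forall U V : opens T, V `<=` U -> {linear sections U -> sections V};
  res_id : forall (U : opens T) (h : U `<=` U) (s : sections U), res h s = s;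
  res_comp : forall (U V W : opens T) (hVU : V `<=` U) (hWV : W `<=` V)
    (hWU : W `<=` U) (s : sections U), res hWV (res hVU s) = res hWU s }.

Arguments res {T p U V}.
Arguments res_id {T p U}.
Arguments res_comp {T p U V W}.

Lemma res_eq_sub (T : topologicalType) (F : presheaf T) (A B V W : opens T)
    (hVA : V `<=` A) (hVB : V `<=` B) (hWA : W `<=` A) (hWB : W `<=` B)
    (hWV : W `<=` V) (s : F A) (t : F B) :
  res hVA s = res hVB t -> res hWA s = res hWB t.
Proof.
by move=> E; rewrite -(res_comp hVA hWV hWA) -(res_comp hVB hWV hWB) E.
Qed.

(* The uniqueness half of [exists!] is the locality axiom. *)
Definition is_sheaf (T : topologicalType) (F : presheaf T) : Prop :=
  forall (I : Type) (U : opens T) (C : I -> opens T)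
    (CU : forall i, C i `<=` U), U `<=` \bigcup_i C i ->
  forall s : forall i, F (C i),
    (forall i j, res (@subIsetl _ (C i) (C j) : opensI (C i) (C j) `<=` C i) (s i)
               = res (@subIsetr _ (C i) (C j) : opensI (C i) (C j) `<=` C j) (s j)) ->
    exists! t : F U, forall i, res (CU i) t = s i.

Record sheaf (T : topologicalType) := Sheaf {
  sheaf_presheaf :> presheaf T;
  sheafP : is_sheaf sheaf_presheaf }.

Record sheaf_hom (T : topologicalType) (F G : sheaf T) := SheafHom {
  hom_at :> forall U : opens T, {linear F U -> G U};
  hom_natural : forall (U V : opens T) (h : V `<=` U) (s : F U),
    hom_at V (res h s) = res h (hom_at U s) }.

Definition sheaf_isomorphic (T : topologicalType) (F G : sheaf T) : Prop :=
  exists (phi : sheaf_hom F G) (psi : sheaf_hom G F),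
    (forall U, cancel (phi U) (psi U)) /\ (forall U, cancel (psi U) (phi U)).

(* When [T] is the type of points of a set [U], [near] refers to the subspace
   topology of [U]. *)
Definition locally_constant (T : topologicalType) (M : Type) : set (T -> M) :=
  [set g | forall x : T, \forall y \near x, g y = g x].

Section LocallyConstantFunctions.
Variables (T : topologicalType) (M : lmodType rat).

Definition lcpred : {pred T -> M} := mem (@locally_constant T M).

Record lcfun := LCFun {
  lcfun_val : T -> M;
  lcfun_mem : lcfun_val \in lcpred }.

HB.instance Definition _ := [isSub for lcfun_val].
HB.instance Definition _ := [Choice of lcfun by <:].

Lemma locally_constant_submod : submod_closed lcpred.
Proof.
split; first by rewrite inE => x /=; exact: nearW.
move=> a f g /set_mem lf /set_mem lg; apply/mem_set => x /=.
by near=> y; congr (_ *: _ + _); near: y; [exact: lf|exact: lg].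
Unshelve. all: by end_near. Qed.

HB.instance Definition _ := GRing.isSubmodClosed.Build _ _ lcpred
  locally_constant_submod.
HB.instance Definition _ := [SubChoice_isSubLmodule of lcfun by <:].

End LocallyConstantFunctions.

Lemma nbhs_set_type (T : topologicalType) (U : opens T) (x : U) (P : set U) :
  nbhs x P <->
  \forall z \near \val x, forall Uz : z \in opens_set U, P (exist _ z Uz).
Proof.
split.
  case=> _ [[W oW <-] Wx WP].
  have : nbhs (\val x) W by exact: open_nbhs_nbhs.
  by apply: filterS => z Wz Uz; apply: WP.
move=> Px; have : nbhs (\val x) _ := Px; rewrite (@nbhsE T) => -[W [oW Wx] WP].
exists (set_val @^-1` W); split; [by exists W | by [] |].
by move=> [z Uz] /= Wz; apply: WP.
Qed.

Definition inclusion (T : topologicalType) (U V : opens T) (h : V `<=` U)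
    (x : V) : U :=
  exist _ (\val x) (mem_set (h _ (set_mem (valP x)))).

Lemma inclusion_near (T : topologicalType) (U V : opens T) (h : V `<=` U)
    (x : V) (P : set U) :
  (\forall y \near inclusion h x, P y) <->
  (\forall y \near x, P (inclusion h y)).
Proof.
split=> /nbhs_set_type Px; apply/nbhs_set_type.
  by apply: filterS Px => z + Uz; apply.
have Vx : nbhs (\val x) V.
  by apply: open_nbhs_nbhs; split; [exact: opensP | exact: set_mem (valP x)].
near=> z => Uz; have Vz : z \in opens_set V by apply/mem_set; near: z.
suff : P (inclusion h (exist _ z Vz)).
  by rewrite /inclusion /= (Prop_irrelevance (mem_set _) Uz).
by move: Vz; near: z.
Unshelve. all: by end_near. Qed.

Section ConstantSheaf.
Variables (T : topologicalType) (M : lmodType rat).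

Lemma const_res_subproof (U V : opens T) (h : V `<=` U) (s : lcfun U M) :
  (lcfun_val s \o inclusion h) \in @lcpred V M.
Proof.
apply/mem_set => x /=.
by apply/(inclusion_near h x (fun y => _ y = _)); exact: (set_mem (lcfun_mem s)).
Qed.

Definition const_res (U V : opens T) (h : V `<=` U) (s : lcfun U M) :
  lcfun V M := LCFun (const_res_subproof h s).

Lemma const_res_linear (U V : opens T) (h : V `<=` U) :
  linear (@const_res U V h).
Proof. by move=> a s t; apply/val_inj. Qed.

HB.instance Definition _ (U V : opens T) (h : V `<=` U) :=
  GRing.isLinear.Build rat (lcfun U M) (lcfun V M) _ (@const_res U V h)
    (@const_res_linear U V h).

Lemma const_res_id (U : opens T) (h : U `<=` U) (s : lcfun U M) :
  const_res h s = s.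
Proof.
by apply/val_inj/funext => x /=; congr lcfun_val; exact/val_inj.
Qed.

Lemma const_res_comp (U V W : opens T) (hVU : V `<=` U) (hWV : W `<=` V)
    (hWU : W `<=` U) (s : lcfun U M) :
  const_res hWV (const_res hVU s) = const_res hWU s.
Proof.
by apply/val_inj/funext => x /=; congr lcfun_val; exact/val_inj.
Qed.

(* Locally constant functions are the continuous ones for [M] discrete, so this
   is the sheafification of the constant presheaf with value [M]. *)
Definition const_presheaf : presheaf T :=
  @Presheaf T (fun U => lcfun U M : lmodType rat)
    (fun U V h => @const_res U V h) const_res_id const_res_comp.

Lemma const_is_sheaf : is_sheaf const_presheaf.
Proof.
move=> I U C CU UC s sE.
have cov (x : U) : exists i, opens_set (C i) (\val x).
  by have [i _ Ci] := UC _ (set_mem (valP x)); exists i.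
have agree i j z (Ci : z \in opens_set (C i)) (Cj : z \in opens_set (C j)) :
    lcfun_val (s i) (exist _ z Ci) = lcfun_val (s j) (exist _ z Cj).
  have Cij : z \in opens_set (opensI (C i) (C j)).
    by apply/mem_set; split; exact: set_mem.
  have /(congr1 (fun g : lcfun (set_type (opensI (C i) (C j))) M => lcfun_val g (exist _ z Cij))) := sE i j.
  rewrite /= /inclusion /=.
  by rewrite (Prop_irrelevance (mem_set _) Ci) (Prop_irrelevance (mem_set _) Cj).
pose ix (x : U) := sval (cid (cov x)).
have Cix (x : U) : \val x \in opens_set (C (ix x)).
  by apply/mem_set; rewrite /ix; case: cid.
pose g (x : U) : M := lcfun_val (s (ix x)) (exist _ (\val x) (Cix x)).
have gE i (x : C i) : g (inclusion (CU i) x) = lcfun_val (s i) x.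
  by case: x => z Ci; exact: agree.
have glc : g \in @lcpred U M.
  apply/mem_set => x.
  pose x' : C (ix x) := exist _ (\val x) (Cix x).
  have -> : x = inclusion (CU (ix x)) x' by exact/val_inj.
  apply/(inclusion_near _ x' (fun y => g y = _)).
  have /set_mem/(_ x') := lcfun_mem (s (ix x)).
  by apply: filterS => y; rewrite !gE.
exists (LCFun glc); split=> [i | t tE].
  by apply/val_inj/funext => x /=; exact: gE.
apply/val_inj/funext => x /=.
pose x' : C (ix x) := exist _ (\val x) (Cix x).
have -> : x = inclusion (CU (ix x)) x' by exact/val_inj.
by rewrite gE -tE.
Qed.

Definition const_sheaf : sheaf T := Sheaf const_is_sheaf.

End ConstantSheaf.

Section DirectImage.
Variables (X Y : topologicalType) (f : X -> Y) (cf : continuous f).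
Variable F : sheaf X.

Definition opens_preimage (V : opens Y) : opens X :=
  Opens ((continuousP _).1 cf _ (opensP V)).

Definition direct_presheaf : presheaf Y :=
  @Presheaf Y (fun V => F (opens_preimage V))
    (fun U V h =>
       @res X F (opens_preimage U) (opens_preimage V) (preimage_subset h))
    (fun U h s => res_id _ s) (fun U V W hVU hWV hWU s => res_comp _ _ _ s).

Lemma direct_is_sheaf : is_sheaf direct_presheaf.
Proof.
move=> I U C CU UC s sE.
apply: (@sheafP X F I (opens_preimage U) (fun i => opens_preimage (C i))
  (fun i => preimage_subset (CU i)) _ s).
  by move=> x /UC [i _ Ci]; exists i.
move=> i j.
by apply: (@res_eq_sub X F (opens_preimage (C i)) (opens_preimage (C j))
  (opens_preimage (opensI (C i) (C j))) _ _ _ _ _ _ _ _ (sE i j)).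
Qed.

Definition direct_image : sheaf Y := Sheaf direct_is_sheaf.

End DirectImage.

Section DirectSum.
Variables (T : topologicalType) (F G : sheaf T).

Definition sum_res (U V : opens T) (h : V `<=` U)
    (s : (F U * G U)%type) : (F V * G V)%type :=
  (res h s.1, res h s.2).

Lemma sum_res_linear (U V : opens T) (h : V `<=` U) :
  linear (@sum_res U V h).
Proof. by move=> a s t; rewrite /sum_res /= !linearP. Qed.

HB.instance Definition _ (U V : opens T) (h : V `<=` U) :=
  GRing.isLinear.Build rat (F U * G U)%type (F V * G V)%type _ (@sum_res U V h)
    (@sum_res_linear U V h).

Lemma sum_res_id (U : opens T) (h : U `<=` U) (s : (F U * G U)%type) :
  sum_res h s = s.
Proof. by case: s => s t; rewrite /sum_res /= !res_id. Qed.

Lemma sum_res_comp (U V W : opens T) (hVU : V `<=` U) (hWV : W `<=` V)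
    (hWU : W `<=` U) (s : (F U * G U)%type) :
  sum_res hWV (sum_res hVU s) = sum_res hWU s.
Proof. by congr pair; exact: res_comp. Qed.

Definition sum_presheaf : presheaf T :=
  @Presheaf T (fun U => (F U * G U)%type : lmodType rat)
    (fun U V h => @sum_res U V h) sum_res_id sum_res_comp.

Lemma sum_is_sheaf : is_sheaf sum_presheaf.
Proof.
move=> I U C CU UC s sE.
have [|t [tE tU]] := @sheafP T F I U C CU UC (fun i => (s i).1).
  by move=> i j; have [] := sE i j.
have [|u [uE uU]] := @sheafP T G I U C CU UC (fun i => (s i).2).
  by move=> i j; have [] := sE i j.
exists (t, u); split=> [i|[t' u'] tuE].
  by rewrite [s i]surjective_pairing -tE -uE.
by congr pair; [apply: tU | apply: uU] => i; rewrite -tuE.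
Qed.

Definition direct_sum : sheaf T := Sheaf sum_is_sheaf.

End DirectSum.

Section Restriction.
Variables (T : topologicalType) (U : opens T) (F : sheaf T).

Lemma opens_image_subproof (W : opens U) :
  open ((fun x : U => \val x) @` W).
Proof.
have [W' oW' W'E] := opensP W.
rewrite (_ : _ @` _ = U `&` W'); first exact: openI (opensP U) oW'.
apply/seteqP; split=> [_ [x Wx <-]|x [Ux W'x]].
  by move: Wx; rewrite -W'E => W'x; split; [exact: set_mem (valP x)|].
by exists (exist _ x (mem_set Ux)); rewrite -?W'E.
Qed.

Definition opens_image (W : opens U) : opens T :=
  Opens (@opens_image_subproof W).

Definition restrict_presheaf : presheaf U :=
  @Presheaf U (fun W => F (opens_image W))
    (fun V W h =>
       @res T F (opens_image V) (opens_image W) (image_subset (fun x : U => \val x) h))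
    (fun V h s => res_id _ s) (fun V W Z hWV hZW hZV s => res_comp _ _ _ s).

Lemma restrict_is_sheaf : is_sheaf restrict_presheaf.
Proof.
move=> I V C CV VC s sE.
apply: (@sheafP T F I (opens_image V) (fun i => opens_image (C i))
  (fun i => image_subset (fun x : U => \val x) (CV i)) _ s).
  by move=> _ [x /VC [i _ Ci] <-]; exists i => //; exists x.
move=> i j.
apply: (@res_eq_sub T F (opens_image (C i)) (opens_image (C j))
  (opens_image (opensI (C i) (C j))) _ _ _ _ _ _ _ _ (sE i j)).
by move=> _ [[x Cix <-] [y Cjy /val_inj yx]]; exists x => //; split=> //; rewrite -yx.
Qed.

Definition restriction : sheaf U := Sheaf restrict_is_sheaf.

End Restriction.

(* The finite-dimensional stalk [M] may depend on [x], its dimension may not. *)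
Definition local_system_of_rank (T : topologicalType) (r : nat) (F : sheaf T) :
    Prop :=
  forall x : T, exists (U : opens T) (M : vectType rat),
    [/\ opens_set U x, dim M = r &
        sheaf_isomorphic (restriction U F) (const_sheaf (set_type U) M)].

(* Main.v *)
Require Import Defs.
From HB Require Import structures.
From mathcomp Require Import all_boot all_order all_algebra.
From mathcomp Require Import all_classical all_reals all_analysis.

(** Averaging a section over the fibres of [f] is a morphism from the direct image
to the constant sheaf, and pulling functions back along [f] is a section of it;
hence the direct image is the sum of the constant sheaf and the kernel of the
average. Over an evenly covered open set, a section of the kernel is a family of
[n] locally constant functions with sum zero, one on each sheet, and is determined
by [n - 1] of them. *)

Set Implicit Arguments.
Unset Strict Implicit.
Unset Printing Implicit Defensive.

Import GRing.Theory Num.Theory.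

Local Open Scope classical_set_scope.
Local Open Scope ring_scope.

(** * Kernel of a linear map as a module *)

Section LinearKernel.
Variables (V W : lmodType rat) (phi : {linear V -> W}).

Definition kerpred : {pred V} := [pred v | phi v == 0].

Record lin_kernel := LinKernel {
  kernel_val : V;
  kernel_mem : kernel_val \in kerpred }.

HB.instance Definition _ := [isSub for kernel_val].
HB.instance Definition _ := [Choice of lin_kernel by <:].

Lemma kerpred_submod : submod_closed kerpred.
Proof.
split=> [|a u v]; rewrite !inE ?linear0 //= => /eqP u0 /eqP v0.
by rewrite linearP u0 v0 scaler0 addr0.
Qed.

HB.instance Definition _ := GRing.isSubmodClosed.Build _ _ kerpred
  kerpred_submod.
HB.instance Definition _ := [SubChoice_isSubLmodule of lin_kernel by <:].

Lemma kernel_eq0 (v : lin_kernel) : phi (kernel_val v) = 0.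
Proof. by apply/eqP; case: v. Qed.

Lemma kernelI (v : V) : phi v = 0 -> v \in kerpred.
Proof. by move/eqP. Qed.

End LinearKernel.

(** * Kernel of a morphism of sheaves *)

Section KernelSheaf.
Variables (T : topologicalType) (F G : sheaf T) (phi : sheaf_hom F G).

Definition ker_sections (U : opens T) : lmodType rat := lin_kernel (phi U).

Lemma ker_res_subproof (U V : opens T) (h : V `<=` U) (s : ker_sections U) :
  res h (kernel_val s) \in kerpred (phi V).
Proof. by apply: kernelI; rewrite hom_natural kernel_eq0 linear0. Qed.

Definition ker_res (U V : opens T) (h : V `<=` U) (s : ker_sections U) :
  ker_sections V := LinKernel (ker_res_subproof h s).

Lemma ker_res_linear (U V : opens T) (h : V `<=` U) : linear (@ker_res U V h).
Proof. by move=> a s t; apply/val_inj; exact: linearP. Qed.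

HB.instance Definition _ (U V : opens T) (h : V `<=` U) :=
  GRing.isLinear.Build rat (ker_sections U) (ker_sections V) _ (@ker_res U V h)
    (@ker_res_linear U V h).

Lemma ker_res_id (U : opens T) (h : U `<=` U) (s : ker_sections U) :
  ker_res h s = s.
Proof. by apply/val_inj; exact: res_id. Qed.

Lemma ker_res_comp (U V W : opens T) (hVU : V `<=` U) (hWV : W `<=` V)
    (hWU : W `<=` U) (s : ker_sections U) :
  ker_res hWV (ker_res hVU s) = ker_res hWU s.
Proof. by apply/val_inj; exact: res_comp. Qed.

Definition ker_presheaf : presheaf T :=
  @Presheaf T ker_sections (fun U V h => @ker_res U V h) ker_res_id
    ker_res_comp.

Lemma ker_is_sheaf : is_sheaf ker_presheaf.
Proof.
move=> I U C CU UC s sE.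
have [|t [tE tU]] := @sheafP T F I U C CU UC (fun i => kernel_val (s i)).
  move=> i j.
  by have /(congr1 (fun k : ker_sections (opensI (C i) (C j)) => kernel_val k))
    := sE i j.
have t0 : phi U t = 0.
  (* Locality of [G]: both [phi U t] and 0 glue the zero family, so they coincide and the section
     glued in [F] stays in the kernel. *)
  have [|u [uE uU]] := @sheafP T G I U C CU UC (fun=> 0).
    by move=> i j; rewrite !linear0.
  rewrite -(uU 0) => [|i]; last by rewrite linear0.
  by apply/esym/uU => i; rewrite -hom_natural tE kernel_eq0.
exists (LinKernel (kernelI t0)); split=> [i|t' t'E]; apply/val_inj.
  exact: tE.
by apply: tU => i; rewrite -t'E.
Qed.

Definition ker_sheaf : sheaf T := Sheaf ker_is_sheaf.

End KernelSheaf.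

(** * Splitting a morphism of sheaves that has a right inverse *)

Section Splitting.
Variables (T : topologicalType) (F G : sheaf T).
Variables (phi : sheaf_hom F G) (iota : sheaf_hom G F).
Hypothesis iotaK : forall U, cancel (iota U) (phi U).

Lemma split_ker_subproof (U : opens T) (s : F U) :
  s - iota U (phi U s) \in kerpred (phi U).
Proof. by apply: kernelI; rewrite linearB iotaK subrr. Qed.

Definition split_at (U : opens T) (s : F U) : direct_sum G (ker_sheaf phi) U :=
  (phi U s, LinKernel (split_ker_subproof s)).

Definition unsplit_at (U : opens T) (s : direct_sum G (ker_sheaf phi) U) : F U :=
  iota U s.1 + kernel_val s.2.

Lemma split_linear (U : opens T) : linear (@split_at U).
Proof.
move=> a s t; congr pair; first exact: linearP.
by apply/val_inj; rewrite /= !linearP scalerDr addrACA.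
Qed.

Lemma unsplit_linear (U : opens T) : linear (@unsplit_at U).
Proof.
by move=> a s t; rewrite /unsplit_at /= linearP scalerDr addrACA.
Qed.

HB.instance Definition _ (U : opens T) :=
  GRing.isLinear.Build rat (F U) (direct_sum G (ker_sheaf phi) U) _ (@split_at U)
    (@split_linear U).
HB.instance Definition _ (U : opens T) :=
  GRing.isLinear.Build rat (direct_sum G (ker_sheaf phi) U) (F U) _
    (@unsplit_at U) (@unsplit_linear U).

Lemma split_natural (U V : opens T) (h : V `<=` U) (s : F U) :
  split_at (res h s) = res h (split_at s).
Proof.
congr pair; first exact: hom_natural.
by apply/val_inj; rewrite /= !hom_natural linearB.
Qed.

Lemma unsplit_natural (U V : opens T) (h : V `<=` U)
    (s : direct_sum G (ker_sheaf phi) U) :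
  unsplit_at (res h s) = res h (unsplit_at s).
Proof. by rewrite /unsplit_at linearD /= hom_natural. Qed.

(** This is the decomposition of [s] as [iota (phi s)] plus [s - iota (phi s)]. It is unique because
    [phi] kills the second summand and undoes [iota] on the first. *)
Lemma split_sheaf_iso : sheaf_isomorphic F (direct_sum G (ker_sheaf phi)).
Proof.
exists (@SheafHom T F (direct_sum G (ker_sheaf phi)) (fun U => @split_at U)
  split_natural).
exists (@SheafHom T (direct_sum G (ker_sheaf phi)) F (fun U => @unsplit_at U)
  unsplit_natural).
split=> U s /=; first by rewrite /unsplit_at /= addrC subrK.
have phiE : phi U (unsplit_at s) = s.1.
  by rewrite /unsplit_at linearD iotaK kernel_eq0 addr0.
case: s phiE => s k phiE; congr pair => //.
by apply/val_inj; rewrite /= phiE /unsplit_at addrC addKr.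
Qed.

End Splitting.

(** * Locally constant functions on an open set as functions on the whole space *)

Section Extension.
Variables (T : topologicalType) (M : lmodType rat).

(* Extension by zero; it lets sections over different opens be compared as
   functions on the whole space. *)
Definition ext (U : opens T) (s : lcfun U M) (x : T) : M :=
  if insub x is Some u then lcfun_val s u else 0.

Lemma ext_val (U : opens T) (s : lcfun U M) (u : U) :
  ext s (\val u) = lcfun_val s u.
Proof. by rewrite /ext valK. Qed.

Lemma ext_inj (U : opens T) (s t : lcfun U M) :
  (forall x, opens_set U x -> ext s x = ext t x) -> s = t.
Proof.
move=> st; apply/val_inj/funext => u /=.
by rewrite -!ext_val; apply: st; exact: set_mem (valP u).
Qed.

Lemma ext_linear (U : opens T) (x : T) : linear (fun s : lcfun U M => ext s x).
Proof.
by move=> a s t; rewrite /ext; case: insub => //; rewrite scaler0 addr0.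
Qed.

Lemma ext0 (U : opens T) (x : T) : ext (0 : lcfun U M) x = 0.
Proof. by rewrite /ext; case: insub. Qed.

Lemma ext_near (U : opens T) (s : lcfun U M) (x : T) : opens_set U x ->
  \forall z \near x, ext s z = ext s x.
Proof.
move=> Ux; pose u : U := exist _ x (mem_set Ux).
have /nbhs_set_type := set_mem (lcfun_mem s) u.
have Unear : nbhs x U by apply: open_nbhs_nbhs; split; [exact: opensP|].
by apply: filterS2 Unear => z Uz /(_ (mem_set Uz)); rewrite -!ext_val.
Qed.

Lemma lcfun_of_subproof (U : opens T) (h : T -> M) :
  (forall x, opens_set U x -> \forall z \near x, h z = h x) ->
  (fun u : U => h (\val u)) \in @lcpred U M.
Proof.
move=> hlc; apply/mem_set => u; apply/nbhs_set_type.
by apply: filterS (hlc _ (set_mem (valP u))) => z.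
Qed.

(** The passage converse to [ext]. Only the germs of [h] at points of [U] are constrained, so [h]
    may be arbitrary elsewhere. *)
Definition lcfun_of (U : opens T) (h : T -> M)
    (hlc : forall x, opens_set U x -> \forall z \near x, h z = h x) :
  lcfun U M := LCFun (lcfun_of_subproof hlc).

Lemma ext_lcfun_of (U : opens T) (h : T -> M)
    (hlc : forall x, opens_set U x -> \forall z \near x, h z = h x) (x : T) :
  opens_set U x -> ext (lcfun_of hlc) x = h x.
Proof. by move=> Ux; rewrite /ext insubT ?mem_set. Qed.

Lemma ext_res (U V : opens T) (h : V `<=` U) (s : lcfun U M) (x : T) :
  opens_set V x -> ext (const_res h s) x = ext s x.
Proof.
move=> Vx; pose v : V := exist _ x (mem_set Vx).
by rewrite (ext_val (const_res h s) v) /= -(ext_val s (inclusion h v)).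
Qed.

End Extension.

(** * Fibres and local trivializations of a covering *)

Section Covering.
Variables (X Y : topologicalType) (f : X -> Y) (n : nat).
Hypothesis hf : covering_map f n.

Lemma fibre_enum (y : Y) : exists e : 'I_n -> X,
  [/\ injective e, forall i, f (e i) = y &
      forall x, f x = y -> exists i, e i = x].
Proof.
have /card_set_bijP[b [b_fun b_inj b_surj]] := covering_degree hf y.
(* [e] is the inverse of the bijection [b] from the fibre to the first [n] integers. *)
have /choice[e eP] (i : 'I_n) : exists x, f x = y /\ b x = i.
  by have [x fx bx] := b_surj i (ltn_ord i); exists x.
exists e; split=> [i j eij|i|x fx]; last 2 first.
- by have [] := eP i.
- have bx : (b x < n)%N by exact: b_fun fx.
  exists (Ordinal bx); have [fe be] := eP (Ordinal bx).
  by apply: b_inj; rewrite ?inE.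
- by apply/val_inj; rewrite /= -(eP i).2 -(eP j).2 eij.
Qed.

(** Identifies the preimage of [V] with the product of [V] and ['I_n]: [g i] is the section onto
    sheet [i], and [k] reads off the sheet of a point. Both are total functions, meaningful only
    over [V]. An even covering has an arbitrary index type, so its sheets are renumbered by the
    points of the fibre over [y0]. *)
Lemma local_trivialization (y0 : Y) :
  exists (V : opens Y) (g : 'I_n -> Y -> X) (k : X -> 'I_n),
  [/\ opens_set V y0,
      forall i y, opens_set V y -> f (g i y) = y /\ k (g i y) = i,
      forall x, opens_set V (f x) -> g (k x) (f x) = x,
      forall i y, opens_set V y -> {for y, continuous (g i)} &
      forall x, opens_set V (f x) -> \forall z \near x, k z = k x].
Proof.
have [V [oV Vy0 [I [S [oS S_triv SE homeo]]]]] := covering_even hf y0.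
have [h hP] := choice homeo.
have hS i y : V y -> S i (h i y).
  by have [[_ im] _ _ _ _] := hP i => Vy; apply: im; exists y.
have fh i y : V y -> f (h i y) = y by have [_ _ fh _ _] := hP i => /fh.
have hf_id i x : S i x -> h i (f x) = x by have [_ gf _ _ _] := hP i => /gf.
have [e [e_inj fe _]] := fibre_enum y0.
(* [j i] is the sheet through the point [e i] of the fibre over [y0]. *)
have /choice[j jS] (i : 'I_n) : exists l, S l (e i).
  have : (f @^-1` V) (e i) by rewrite /= fe.
  by rewrite SE => -[l _]; exists l.
pose g i := h (j i).
(* The [n] points [g i y] of the fibre over [y] lie on distinct sheets, so they
   exhaust the fibre; no sheet is left out. *)
have g_inj y : V y -> injective (g ^~ y).
  move=> Vy i i' gE; have jE : j i = j i'.
    apply: S_triv => //; exists (g i y); split; first exact: hS.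
    by rewrite [g i y]gE; exact: hS.
  by apply: e_inj; rewrite -(hf_id _ _ (jS i)) -(hf_id _ _ (jS i')) !fe jE.
have /choice[k kP] (x : X) : exists i, V (f x) -> g i (f x) = x.
  have [e' [e'_inj fe' e'_surj]] := fibre_enum (f x).
  have [i0 e'i0] := e'_surj x erefl.
  (* When [f x] lies outside [V] the requirement is void, and [i0] just supplies an element of
     ['I_n]. *)
  have [Vfx|nVfx] := pselect (V (f x)); last by exists i0.
  have /choice[s sP] (i : 'I_n) : exists l, e' l = g i (f x).
    by apply: e'_surj; exact: fh.
  have s_inj : injective s.
    by move=> i i' sE; apply: (g_inj _ Vfx); rewrite -!sP sE.
  have [t _ tK] := injF_bij s_inj.
  by exists (t i0) => _; rewrite -sP tK.
exists (Opens oV), g, k; split=> //= [i y Vy|i y Vy|x Vfx].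
- have fg : f (g i y) = y by exact: fh.
  (* By [kP], the section numbered [k (g i y)] passes through [g i y], as does section [i]; distinct
     sections have distinct values at [y]. *)
  split=> //; apply: (g_inj y Vy).
  by have := kP (g i y); rewrite fg; exact.
- have [_ _ _ _] := hP (j i).
  by rewrite continuous_open_subspace // => /(_ y); apply; exact: mem_set.
(* [k] is constant on the open sheet through [x]: for [z] in that sheet, the sections numbered [k x]
   and [k z] both send [f z] to [z]. *)
- have Sx : nbhs x (S (j (k x))).
    apply: open_nbhs_nbhs; split=> //.
    by rewrite -[X in S _ X]kP //; exact: hS.
  apply: filterS Sx => z Sz.
  have Vfz : V (f z) by have : (\bigcup_i S i) z; [exists (j (k x))|rewrite -SE].
  by apply: (g_inj _ Vfz); rewrite kP // /g hf_id.
Qed.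

End Covering.

(** * Averaging over fibres and pulling back *)

Section Average.
Variables (X Y : topologicalType) (f : X -> Y) (n : nat).
Hypothesis hf : covering_map f n.
Variable M : lmodType rat.

Let cf := covering_continuous hf.

(** The enumeration is chosen fibre by fibre, with no continuity in [y]; [averageE] makes the choice
    immaterial. *)
Definition fibre_pt (y : Y) : 'I_n -> X := sval (cid (fibre_enum hf y)).

Lemma fibre_ptK (y : Y) (i : 'I_n) : f (fibre_pt y i) = y.
Proof. by rewrite /fibre_pt; case: cid => e []. Qed.

Definition average (h : X -> M) (y : Y) : M :=
  n%:R^-1 *: \sum_(i < n) h (fibre_pt y i).

(** An injective family of [n] points in a fibre of [n] points is a permutation of the chosen
    enumeration. This allows continuous local sections to replace [fibre_pt]. *)
Lemma averageE (h : X -> M) (y : Y) (p : 'I_n -> X) : injective p ->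
  (forall i, f (p i) = y) -> average h y = n%:R^-1 *: \sum_(i < n) h (p i).
Proof.
move=> p_inj fp; rewrite /average /fibre_pt; case: cid => e [e_inj fe e_surj] /=.
have /choice[s sP] (i : 'I_n) : exists l, e l = p i by exact: e_surj.
have s_inj : injective s by move=> i j sE; apply: p_inj; rewrite -!sP sE.
rewrite (reindex s) /=; last exact/onW_bij/injF_bij.
by congr (_ *: _); apply: eq_bigr => i _; rewrite sP.
Qed.

Lemma eq_average (h h' : X -> M) (y : Y) :
  (forall x, f x = y -> h x = h' x) -> average h y = average h' y.
Proof.
move=> hh'; congr (_ *: _); apply: eq_bigr => i _; apply: hh'.
exact: fibre_ptK.
Qed.

(** Near [y] the average runs over the sections [g i] of a trivialization. Each [h (g i z)] is
    constant for [z] near [y], and finitely many such conditions hold on a common neighbourhood. *)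
Lemma average_near (U : opens Y) (h : X -> M) :
  (forall x, opens_set U (f x) -> \forall z \near x, h z = h x) ->
  forall y, opens_set U y -> \forall z \near y, average h z = average h y.
Proof.
move=> hlc y Uy.
have [V [g [k [Vy gP _ g_cont _]]]] := local_trivialization hf y.
have gE z : opens_set V z -> average h z = n%:R^-1 *: \sum_(i < n) h (g i z).
  move=> Vz; apply: averageE => [i j gij|i]; last by case: (gP i z Vz).
  by have [_ <-] := gP i z Vz; rewrite gij; case: (gP j z Vz).
have near_g : \forall z \near y, forall i, h (g i z) = h (g i y).
  apply: filter_forall => i.
  have hx : \forall x \near g i y, h x = h (g i y).
    by apply: hlc; rewrite (gP i y Vy).1.
  exact: (g_cont i y Vy _ hx).
have Vnear : nbhs y V by apply: open_nbhs_nbhs; split; [exact: opensP|].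
apply: filterS2 Vnear near_g => z Vz hg.
by rewrite !gE //; congr (_ *: _); apply: eq_bigr.
Qed.

Lemma average_sections_near (U : opens Y)
    (s : lcfun (opens_preimage cf U) M) (y : Y) : opens_set U y ->
  \forall z \near y, average (ext s) z = average (ext s) y.
Proof. by apply: average_near => x Ux; exact: ext_near. Qed.

Definition average_at (U : opens Y) (s : lcfun (opens_preimage cf U) M) :
  lcfun U M := lcfun_of (@average_sections_near U s).

Lemma average_linear (U : opens Y) : linear (@average_at U).
Proof.
move=> a s t; apply: ext_inj => y Uy; rewrite ext_linear !ext_lcfun_of //.
rewrite /average scalerA mulrC -scalerA -scalerDr; congr (_ *: _).
rewrite scaler_sumr -big_split /=.
by apply: eq_bigr => i _; rewrite ext_linear.
Qed.

HB.instance Definition _ (U : opens Y) :=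
  GRing.isLinear.Build rat (lcfun (opens_preimage cf U) M) (lcfun U M) _
    (@average_at U) (@average_linear U).

Lemma pullback_near (U : opens Y) (t : lcfun U M) (x : X) :
  opens_set (opens_preimage cf U) x ->
  \forall z \near x, ext t (f z) = ext t (f x).
Proof. by move=> Ux; apply: (cf (ext_near t Ux)). Qed.

Definition pullback_at (U : opens Y) (t : lcfun U M) :
  lcfun (opens_preimage cf U) M := lcfun_of (@pullback_near U t).

Lemma pullback_linear (U : opens Y) : linear (@pullback_at U).
Proof.
move=> a s t; apply: ext_inj => x Ux.
by rewrite ext_linear !ext_lcfun_of ?ext_linear.
Qed.

HB.instance Definition _ (U : opens Y) :=
  GRing.isLinear.Build rat (lcfun U M) (lcfun (opens_preimage cf U) M) _
    (@pullback_at U) (@pullback_linear U).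

Lemma average_natural (U V : opens Y) (h : V `<=` U)
    (s : direct_image cf (const_sheaf X M) U) :
  average_at (res h s) = res h (average_at s : const_sheaf Y M U).
Proof.
apply: ext_inj => y Vy; rewrite ext_res // !ext_lcfun_of //; last exact: h.
by apply: eq_average => x fx; rewrite ext_res //= fx.
Qed.

Lemma pullback_natural (U V : opens Y) (h : V `<=` U) (t : const_sheaf Y M U) :
  pullback_at (res h t) =
  res h (pullback_at t : direct_image cf (const_sheaf X M) U).
Proof.
apply: ext_inj => x Vx; rewrite ext_res // !ext_lcfun_of //; last exact: h.
by rewrite ext_res.
Qed.

Definition average_hom :
    sheaf_hom (direct_image cf (const_sheaf X M)) (const_sheaf Y M) :=
  @SheafHom Y (direct_image cf (const_sheaf X M)) (const_sheaf Y M)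
    (fun U => @average_at U) average_natural.

Definition pullback_hom :
    sheaf_hom (const_sheaf Y M) (direct_image cf (const_sheaf X M)) :=
  @SheafHom Y (const_sheaf Y M) (direct_image cf (const_sheaf X M))
    (fun U => @pullback_at U) pullback_natural.

(** A pulled-back function is constant on each fibre, so its average is [n] equal terms divided by
    [n]; positivity makes [n] invertible in [rat]. *)
Lemma pullbackK (U : opens Y) : (0 < n)%N ->
  cancel (pullback_hom U) (average_hom U).
Proof.
move=> n_gt0 t; apply: ext_inj => y Uy; rewrite ext_lcfun_of //.
rewrite (@eq_average _ (fun=> ext t y)) => [|x fx].
  rewrite /average sumr_const card_ord -scaler_nat scalerA mulVf ?scale1r //.
  by rewrite pnatr_eq0 -lt0n.
by rewrite ext_lcfun_of /= fx.
Qed.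

End Average.

(** * Coordinates on vectors with sum zero *)

Section ZeroSumVectors.
Variable m : nat.

(* The vector with sum zero whose coordinates after the first are those of
   [v]. *)
Definition zero_sum_ext (v : 'rV[rat]_m) (i : 'I_m.+1) : rat^o :=
  if unlift ord0 i is Some j then v 0 j else - \sum_j v 0 j.

Lemma zero_sum_ext0 (v : 'rV[rat]_m) : zero_sum_ext v ord0 = - \sum_j v 0 j.
Proof. by rewrite /zero_sum_ext unlift_none. Qed.

Lemma zero_sum_ext_lift (v : 'rV[rat]_m) (j : 'I_m) :
  zero_sum_ext v (lift ord0 j) = v 0 j.
Proof. by rewrite /zero_sum_ext liftK. Qed.

Lemma zero_sum_ext_sum (v : 'rV[rat]_m) : \sum_i zero_sum_ext v i = 0.
Proof.
rewrite big_ord_recl zero_sum_ext0.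
apply/eqP; rewrite addrC subr_eq0; apply/eqP/eq_bigr => j _.
exact: zero_sum_ext_lift.
Qed.

(** The sum condition forces the first coordinate to be minus the sum of the others. With
    [zero_sum_ext_sum], this identifies row vectors of length [m] with zero-sum families of length
    [m.+1]. *)
Lemma zero_sum_extE (w : 'I_m.+1 -> rat^o) (i : 'I_m.+1) : \sum_i w i = 0 ->
  zero_sum_ext (\row_j w (lift ord0 j)) i = w i.
Proof.
rewrite big_ord_recl => /eqP; rewrite addr_eq0 => /eqP w0.
have [j ->|->] := unliftP ord0 i; first by rewrite zero_sum_ext_lift mxE.
rewrite w0 zero_sum_ext0; congr (- _).
by apply: eq_bigr => j _; rewrite mxE.
Qed.

Lemma zero_sum_ext_linear (i : 'I_m.+1) : linear (zero_sum_ext ^~ i).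
Proof.
move=> a u v; rewrite /zero_sum_ext; case: unlift => [j|]; first by rewrite !mxE.
rewrite scalerN scaler_sumr -opprD -big_split; congr (- _).
by apply: eq_bigr => j _; rewrite !mxE.
Qed.

End ZeroSumVectors.

(** * Triviality of the kernel over a trivializing open set *)

Section LocalTriviality.
Variables (X Y : topologicalType) (f : X -> Y) (m : nat).
Hypothesis hf : covering_map f m.+1.
Variables (V : opens Y) (g : 'I_m.+1 -> Y -> X) (k : X -> 'I_m.+1).
Hypothesis g_sec : forall i y, opens_set V y -> f (g i y) = y /\ k (g i y) = i.
Hypothesis kP : forall x, opens_set V (f x) -> g (k x) (f x) = x.
Hypothesis g_cont : forall i y, opens_set V y -> {for y, continuous (g i)}.
Hypothesis k_near : forall x, opens_set V (f x) -> \forall z \near x, k z = k x.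

Let cf := covering_continuous hf.
Let L := ker_sheaf (average_hom hf rat^o).

Lemma opens_image_sub (W : opens V) (y : Y) : opens_set (opens_image W) y ->
  opens_set V y.
Proof. by move=> [v _ <-]; exact: set_mem (valP v). Qed.

Lemma average_sheets (h : X -> rat^o) (y : Y) : opens_set V y ->
  average hf h y = m.+1%:R^-1 *: \sum_i h (g i y).
Proof.
move=> Vy; apply: averageE => [i j gij|i]; last by case: (g_sec i Vy).
by have [_ <-] := g_sec i Vy; rewrite gij; case: (g_sec j Vy).
Qed.

Lemma sum_sheets_kernel (W : opens V) (s : L (opens_image W)) (y : Y) :
  opens_set (opens_image W) y -> \sum_i ext (kernel_val s) (g i y) = 0.
Proof.
move=> Wy; have Vy := opens_image_sub Wy.
have := congr1 (fun t : lcfun (opens_image W) rat^o => ext t y) (kernel_eq0 s).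
rewrite ext_lcfun_of // average_sheets //.
rewrite ext0.
(* The factor [m.+1%:R^-1] is nonzero in [rat], so a vanishing average means a vanishing sum. *)
move/eqP; rewrite scaler_eq0 invr_eq0 pnatr_eq0 /=; exact/eqP.
Qed.

(** Sheet [ord0] is left out: on kernel sections its value is determined by the others. *)
Definition sheet_values (h : X -> rat^o) (v : V) : 'rV[rat]_m :=
  \row_j h (g (lift ord0 j) (\val v)).

Lemma sheet_values_near (W : opens V) (s : L (opens_image W)) (v : V) :
  opens_set W v ->
  \forall z \near v, sheet_values (ext (kernel_val s)) z =
                     sheet_values (ext (kernel_val s)) v.
Proof.
move=> Wv; have Wy : opens_set (opens_image W) (\val v) by exists v.
have Vy := opens_image_sub Wy.
have near_s : \forall y \near \val v, forall i,
    ext (kernel_val s) (g i y) = ext (kernel_val s) (g i (\val v)).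
  apply: filter_forall => i.
  have hx : \forall x \near g i (\val v),
      ext (kernel_val s) x = ext (kernel_val s) (g i (\val v)).
    by apply: ext_near; rewrite /= (g_sec i Vy).1.
  exact: (g_cont Vy hx).
apply/nbhs_set_type; apply: filterS near_s => y sy Uy.
by apply/rowP => j; rewrite !mxE sy.
Qed.

Definition trivialize_at (W : opens V) (s : L (opens_image W)) :
  lcfun W 'rV[rat]_m := lcfun_of (@sheet_values_near W s).

Lemma trivialize_linear (W : opens V) : linear (@trivialize_at W).
Proof.
move=> a s t; apply: ext_inj => v Wv; rewrite ext_linear !ext_lcfun_of //.
by apply/rowP => j; rewrite !mxE ext_linear.
Qed.

HB.instance Definition _ (W : opens V) :=
  GRing.isLinear.Build rat (L (opens_image W)) (lcfun W 'rV[rat]_m) _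
    (@trivialize_at W) (@trivialize_linear W).

(** [t] lives on the subspace [V], so [f x] must first be repackaged as a point of [V]; the default
    0 is taken when it lies outside. *)
Definition from_sheets (W : opens V) (t : lcfun W 'rV[rat]_m) (x : X) : rat^o :=
  if insub (f x) is Some v then zero_sum_ext (ext t v) (k x) else 0.

Lemma from_sheetsE (W : opens V) (t : lcfun W 'rV[rat]_m) (v : V) (x : X) :
  f x = \val v -> from_sheets t x = zero_sum_ext (ext t v) (k x).
Proof. by move=> fx; rewrite /from_sheets fx valK. Qed.

Lemma from_sheets_near (W : opens V) (t : lcfun W 'rV[rat]_m) (x : X) :
  opens_set (opens_preimage cf (opens_image W)) x ->
  \forall z \near x, from_sheets t z = from_sheets t x.
Proof.
move=> Wx; have Vfx := opens_image_sub Wx; case: Wx => v Wv vfx.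
(* Local constancy of [t] is moved from the subspace [V] to [Y], then pulled back to [X] by
   continuity of [f]. *)
have /nbhs_set_type := ext_near t Wv; rewrite vfx => t_near.
have fnear : \forall z \near x, forall Vz : f z \in opens_set V,
  ext t (exist _ (f z) Vz) = ext t v by exact: (cf t_near).
have Vnear : \forall z \near x, opens_set V (f z).
  by apply: (cf (open_nbhs_nbhs _)); split; [exact: opensP|].
near=> z.
have Vz : f z \in opens_set V by apply/mem_set; near: z.
rewrite (from_sheetsE t (v := v) (x := x)) //.
rewrite (from_sheetsE t (v := exist _ (f z) Vz) (x := z)) //.
have -> : k z = k x by near: z; apply: k_near.
by congr (zero_sum_ext _ _); move: Vz; near: z.
Unshelve. all: by end_near. Qed.

(** A fibre meets each sheet once, so the sum over it is the sum of all coordinates of a zero-sum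
    vector. *)
Lemma from_sheets_kernel (W : opens V) (t : lcfun W 'rV[rat]_m) :
  lcfun_of (@from_sheets_near W t)
    \in kerpred (average_hom hf rat^o (opens_image W)).
Proof.
apply: kernelI; apply: ext_inj => y Wy; have Vy := opens_image_sub Wy.
rewrite ext0.
case: (Wy) => v Wv vy.
rewrite ext_lcfun_of // average_sheets //.
rewrite (eq_bigr (zero_sum_ext (ext t v))) ?zero_sum_ext_sum ?scaler0 // => i _.
have [fg kg] := g_sec i Vy.
by rewrite ext_lcfun_of /= ?fg // (from_sheetsE t (v := v)) ?kg ?fg.
Qed.

Definition untrivialize_at (W : opens V) (t : lcfun W 'rV[rat]_m) :
  L (opens_image W) := LinKernel (@from_sheets_kernel W t).

Lemma trivializeK (W : opens V) : cancel (@trivialize_at W) (@untrivialize_at W).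
Proof.
move=> s; apply/val_inj/ext_inj => x Wx /=.
rewrite ext_lcfun_of //; case: (Wx) => v Wv vfx.
rewrite (from_sheetsE _ (v := v)) // ext_lcfun_of //.
have Vfx := opens_image_sub Wx.
(* The values of [s] along a fibre have sum zero, so the value on the omitted sheet is recovered
   too. *)
rewrite [LHS](zero_sum_extE (w := fun i => ext (kernel_val s) (g i (\val v)))).
  by rewrite vfx kP.
by rewrite vfx sum_sheets_kernel.
Qed.

Lemma untrivializeK (W : opens V) : cancel (@untrivialize_at W) (@trivialize_at W).
Proof.
move=> t; apply: ext_inj => v Wv; rewrite ext_lcfun_of //.
have Vv : opens_set V (\val v) by exact: set_mem (valP v).
apply/rowP => j; rewrite mxE /=; have [fg kg] := g_sec (lift ord0 j) Vv.
rewrite ext_lcfun_of /= ?fg; last by exists v.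
by rewrite (from_sheetsE t (v := v)) // kg zero_sum_ext_lift.
Qed.

(** The inverse of a linear bijection is linear; [untrivialize_natural] follows in the same way from
    [trivialize_natural]. *)
Lemma untrivialize_linear (W : opens V) : linear (@untrivialize_at W).
Proof.
move=> a s t; apply: (can_inj (@trivializeK W)).
by rewrite trivialize_linear !untrivializeK.
Qed.

HB.instance Definition _ (W : opens V) :=
  GRing.isLinear.Build rat (lcfun W 'rV[rat]_m) (L (opens_image W)) _
    (@untrivialize_at W) (@untrivialize_linear W).

Lemma trivialize_natural (W Z : opens V) (h : Z `<=` W) (s : restriction V L W) :
  trivialize_at (res h s) =
  res h (trivialize_at s : const_sheaf (set_type V) 'rV[rat]_m W).
Proof.
apply: ext_inj => v Zv; rewrite ext_res // !ext_lcfun_of //; last exact: h.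
have Vv : opens_set V (\val v) by exact: set_mem (valP v).
apply/rowP => j; rewrite !mxE ext_res //=.
by rewrite (g_sec _ Vv).1; exists v.
Qed.

Lemma untrivialize_natural (W Z : opens V) (h : Z `<=` W)
    (t : const_sheaf (set_type V) 'rV[rat]_m W) :
  untrivialize_at (res h t) = res h (untrivialize_at t : restriction V L W).
Proof.
apply: (can_inj (@trivializeK Z)); rewrite untrivializeK trivialize_natural.
by rewrite untrivializeK.
Qed.

Lemma kernel_locally_constant :
  sheaf_isomorphic (restriction V L) (const_sheaf (set_type V) 'rV[rat]_m).
Proof.
exists (@SheafHom _ (restriction V L) (const_sheaf (set_type V) 'rV[rat]_m)
  (fun W => @trivialize_at W) trivialize_natural).
exists (@SheafHom _ (const_sheaf (set_type V) 'rV[rat]_m) (restriction V L)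
  (fun W => @untrivialize_at W) untrivialize_natural).
by split=> W; [exact: trivializeK|exact: untrivializeK].
Qed.

End LocalTriviality.

(** * The local system and the decomposition *)

Lemma kernel_local_system (X Y : topologicalType) (f : X -> Y) (m : nat)
    (hf : covering_map f m.+1) :
  local_system_of_rank m (ker_sheaf (average_hom hf rat^o)).
Proof.
move=> y; have [V [g [k [Vy g_sec kP g_cont k_near]]]] := local_trivialization hf y.
exists V, 'rV[rat]_m; split=> //; first by rewrite dim_matrix; exact: mul1n.
exact: (kernel_locally_constant hf g_sec kP g_cont k_near).
Qed.

Theorem proposition14 (R : realType) (X Y : topologicalType)
  (hX : hausdorff_space X) (pX : path_connected R X)
  (lX : locally_contractible R X) (kX : locally_compact [set: X]%classic)
  (hY : hausdorff_space Y) (pY : path_connected R Y)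
  (lY : locally_contractible R Y) (kY : locally_compact [set: Y]%classic)
  (n : nat) (f : X -> Y) (hf : covering_map f n) :
  exists L : sheaf Y,
    local_system_of_rank n.-1 L /\
    sheaf_isomorphic
      (direct_image (covering_continuous hf) (const_sheaf X rat^o))
      (direct_sum (const_sheaf Y rat^o) L).
Proof.
exists (ker_sheaf (average_hom hf rat^o)).
(* Path-connectedness provides a point [x]; its index [i] in its own fibre inhabits ['I_n], whence
   [n] is positive. *)
have [[x _] _] := pX; have [e [_ _ /(_ x erefl) [i _]]] := fibre_enum hf (f x).
split; last first.
  apply: (@split_sheaf_iso _ _ _ _ (pullback_hom hf rat^o)) => U.
  by apply: pullbackK; exact: leq_ltn_trans (ltn_ord i).
(* The index [i] excludes degree 0, so [n] is [m.+1] and the rank [n.-1] is [m]. *)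
case: n hf e i => [|m] hf e i; first by case: i.
exact: kernel_local_system.
Qed.
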